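(* Consider the problem $\min_{z\in\mathbb{R}^n}\sum_{i=1}^N f_i(z)$ s.t. $z\in\bigcap_{i=1}^N Z_i$, the weight matrix $\mathcal{W}$, the iterates $\boldsymbol{z}^k,\boldsymbol{y}^k$ and $\boldsymbol{x}^k=(\boldsymbol{y}^k,\boldsymbol{z}^k)$ of Proximal-Tracking with step size $c>0$, the set-valued mapping $F$ and the distance $\mathrm{dist}_A$, all as defined in the context. Assume that Assumptions 1 (convexity and solvability), 2 (network), 3 (strong convexity with modulus $\mu$) and 4 (calmness, with constants $\ell\ge 0,\varrho\ge0,\delta\in(0,+\infty]$) stated in the context hold. Set $$C:=\frac{1}{c\mu}+\frac{\ell}{\mu\sigma}+\sqrt{\frac{1+\varrho}{2\sigma c\mu}},\qquad \kappa:=\sqrt{C^2+\Bigl(\frac{1+\varrho+c\ell C}{\sigma}\Bigr)^{2}},\qquad \theta:=\frac{2\underline{\lambda}-\underline{\lambda}^2}{\kappa^2},$$ where $\underline{\lambda}:=\lambda_{\min}(W)>0$. (a) If $\delta=+\infty$, then for all $k\ge 0$, $$\mathrm{dist}_A^2(\boldsymbol{x}^{k+1},F^{-1}(0))\le\frac{1}{1+\theta}\,\mathrm{dist}_A^2(\boldsymbol{x}^{k},F^{-1}(0)).$$ (b) If $\delta<\infty$, then the same inequality holds for all $k\ge k_0$, where $k_0$ is an index such that $\|\boldsymbol{z}^k-\boldsymbol{z}^*\|\le\delta$ for all $k\ge k_0$ (such an index exists).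
   Context: Problem. $N\ge 2$ agents, functions $f_i:\mathbb{R}^n\to\mathbb{R}$ and sets $Z_i\subseteq\mathbb{R}^n$, $i=1,\dots,N$; minimize $\sum_i f_i(z)$ over $z\in\bigcap_i Z_i$. Let $\phi_i:=f_i+\mathcal{I}_{Z_i}$, where $\mathcal{I}_{Z_i}$ is the indicator function ($0$ on $Z_i$, $+\infty$ elsewhere). For $\boldsymbol{z}=(z_1,\dots,z_N)\in\mathbb{R}^{Nn}$ (stacked vectors $z_i\in\mathbb{R}^n$) let $\boldsymbol{\phi}(\boldsymbol{z}):=\sum_i\phi_i(z_i)$ and $\partial\boldsymbol{\phi}(\boldsymbol{z}):=\{(q_1,\dots,q_N): q_i\in\partial\phi_i(z_i)\ \forall i\}$ (convex subdifferentials). Assumption 1: each $f_i$ is convex and lower semicontinuous, each $Z_i$ is convex and closed, and the problem has at least one optimal solution. Assumption 2: the communication graph $\mathcal{G}=(\{1,\dots,N\},\mathcal{E})$ is undirected and connected, and $\mathcal{W}=(w_{ij})\in\mathbb{R}^{N\times N}$, with $w_{ij}>0$ if $(i,j)\in\mathcal{E}$ and $w_{ij}=0$ otherwise, is symmetric, doubly stochastic and positive definite (so the pairs $(i,i)$ are in $\mathcal{E}$). Notation: $W:=\mathcal{W}\otimes I_n$, $I$ is the identity of size $Nn$, $\sigma:=1-\max\{\lambda:\lambda \text{ an eigenvalue of }\mathcal{W},\ \lambda<1\}$. Proximal-Tracking algorithm (step size $c>0$): start from $z_i^0=g_i^0=q_i^0=0\in\mathbb{R}^n$; for $k=0,1,\dots$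 and each $i$, put $\xi_i^k=\sum_{j}w_{ij}z_j^k$, $\iota_i^k=\sum_j w_{ij}g_j^k$, $z_i^{k+1}=\arg\min_{z_i\in Z_i}\{f_i(z_i)+(\iota_i^k-q_i^k)^\top z_i+\frac{1}{2c}\|z_i-\xi_i^k\|^2\}$, $q_i^{k+1}=\frac1c(\xi_i^k-z_i^{k+1})+q_i^k-\iota_i^k$, $g_i^{k+1}=\iota_i^k+q_i^{k+1}-q_i^k$. Stack: $\boldsymbol{z}^k=(z_1^k,\dots,z_N^k)$. Define $\boldsymbol{y}^k:=\sum_{t=0}^k(I-W)\boldsymbol{z}^t$ and $\boldsymbol{x}^k:=(\boldsymbol{y}^k,\boldsymbol{z}^k)$. Mapping $F$: for $\boldsymbol{x}=(\boldsymbol{y},\boldsymbol{z})\in\mathbb{R}^{Nn}\times\mathbb{R}^{Nn}$, $F(\boldsymbol{x}):=\{(I-W)\boldsymbol{z}\}\times(2W-W^2)^{-1}\bigl(c\,\partial\boldsymbol{\phi}(\boldsymbol{z})+(I-W)\boldsymbol{y}\bigr)$ (note $2W-W^2\succ0$), and $F^{-1}(0):=\{\boldsymbol{x}:0\in F(\boldsymbol{x})\}$. Norms: $\|\boldsymbol{x}\|_A^2:=\|\boldsymbol{y}\|^2+\boldsymbol{z}^\top(2W-W^2)\boldsymbol{z}$, $\mathrm{dist}_A^2(\boldsymbol{x},\Omega):=\min_{\boldsymbol{x}'\in\Omega}\|\boldsymbol{x}-\boldsymbol{x}'\|_A^2$; $\mathrm{dist}$ is the Euclidean distance. Assumption 3: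 each $f_i$ is strongly convex with modulus $\mu>0$. Then the optimal solution $z^*$ is unique; $\boldsymbol{z}^*:=\mathbb{1}_N\otimes z^*$ (the vector stacking $N$ copies of $z^*$). Let $\mathcal{Q}^*:=\partial\boldsymbol{\phi}(\boldsymbol{z}^* )\cap\mathrm{Range}(I-W)$, with $\mathcal{Q}^*\ne\emptyset$ (standing). Assumption 4: there exist $\ell\ge0$, $\varrho\ge0$, $\delta\in(0,+\infty]$ such that for any $\boldsymbol{z}$ with $\partial\boldsymbol{\phi}(\boldsymbol{z})\neq\emptyset$ and $\|\boldsymbol{z}-\boldsymbol{z}^*\|\le\delta$ and every $\boldsymbol{q}\in\partial\boldsymbol{\phi}(\boldsymbol{z})$, $\mathrm{dist}(\boldsymbol{q},\mathcal{Q}^* )\le\ell\|\boldsymbol{z}-\boldsymbol{z}^*\|+\varrho\,\mathrm{dist}(\boldsymbol{q},\mathrm{Range}(I-W))$. *)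

(* Defs.v *)
From mathcomp Require Export all_boot all_order all_algebra.
From mathcomp Require Export all_classical all_reals all_analysis.
From mathcomp Require Export mxtens.

Set Implicit Arguments.
Unset Strict Implicit.
Unset Printing Implicit Defensive.

Export Order.TTheory GRing.Theory Num.Theory.
Export numFieldNormedType.Exports.

Local Open Scope classical_set_scope.
Local Open Scope ring_scope.

(* Euclidean structure; the norm `|x| that the library puts on matrices is the
   sup norm. Both induce the same topology on 'cV[R]_m. *)

Definition dotv (R : realType) (m : nat) (u v : 'cV[R]_m) : R :=
  \sum_i u i 0 * v i 0.

Definition enorm (R : realType) (m : nat) (u : 'cV[R]_m) : R :=
  Num.sqrt (dotv u u).

(* The value is 0 if S is empty. *)
Definition dist (R : realType) (m : nat) (u : 'cV[R]_m) (S : set 'cV[R]_m) : R :=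
  inf [set enorm (u - v) | v in S].

Definition mxrange (R : realType) (m : nat) (A : 'M[R]_m) : set 'cV[R]_m :=
  [set A *m v | v in [set: 'cV[R]_m]].

(* The stacked vector (v_1, ..., v_N) has the component j of v_i at position
   mxtens_index (i, j), that is i * n + j: this is the indexing of the library's
   Kronecker product tensmx. *)

Definition stack (R : realType) (N n : nat) (v : 'I_N -> 'cV[R]_n) :
    'cV[R]_(N * n) :=
  \col_k v (mxtens_unindex k).1 (mxtens_unindex k).2 0.

Definition blk (R : realType) (N n : nat) (z : 'cV[R]_(N * n)) (i : 'I_N) :
    'cV[R]_n :=
  \col_j z (mxtens_index (i, j)) 0.

Definition kronI (R : realType) (N n : nat) (w : 'M[R]_N) : 'M[R]_(N * n) :=
  tensmx w (1%:M : 'M[R]_n).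
Arguments kronI {R N} n w.

Definition argmin (R : realType) (T : Type) (S : set T) (h : T -> R) : set T :=
  [set x | S x /\ forall y, S y -> h x <= h y].

Definition optimal_solutions (R : realType) (N n : nat)
    (f : 'I_N -> 'cV[R]_n -> R) (Z : 'I_N -> set 'cV[R]_n) : set 'cV[R]_n :=
  argmin (\bigcap_(i in [set: 'I_N]) Z i) (fun z => \sum_i f i z).

Definition strongly_convex (R : realType) (n : nat) (mu : R)
    (h : 'cV[R]_n -> R) : Prop :=
  forall (x y : 'cV[R]_n) (t : R), 0 <= t <= 1 ->
    h (t *: x + (1 - t) *: y)
      <= t * h x + (1 - t) * h y - mu / 2 * t * (1 - t) * enorm (x - y) ^+ 2.

Record convex_problem (R : realType) (N n : nat)
    (f : 'I_N -> 'cV[R]_n -> R) (Z : 'I_N -> set 'cV[R]_n) : Prop := {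
  problem_convex : forall i, convex_function [set: 'cV[R]_n] (f i);
  problem_lsc : forall i, lower_semicontinuous (fun x => (f i x)%:E);
  problem_convex_set : forall i, convex_set (Z i);
  problem_closed : forall i, closed (Z i);
  problem_solvable : exists z, optimal_solutions f Z z }.

Record network (R : realType) (N : nat) (E : rel 'I_N) (w : 'M[R]_N) : Prop := {
  network_undirected : symmetric E;
  network_connected : forall i j, connect E i j;
  weight_edge : forall i j, E i j -> 0 < w i j;
  weight_nonedge : forall i j, ~~ E i j -> w i j = 0;
  weight_sym : w^T = w;
  weight_row_sum : forall i, \sum_j w i j = 1;
  weight_col_sum : forall j, \sum_i w i j = 1;
  weight_posdef : forall v : 'cV[R]_N, v != 0 -> 0 < dotv v (w *m v) }.

(* Under the network conditions and 2 <= N, the set below is finite and nonempty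
   (w is symmetric and 1 is a simple eigenvalue), so that its sup is its max. *)
Definition spectral_gap (R : realType) (N : nat) (w : 'M[R]_N) : R :=
  1 - sup [set l | eigenvalue w l /\ l < 1].

(* For a symmetric A of positive size the set of eigenvalues is finite and
   nonempty, so that its inf is its min. *)
Definition lambda_min (R : realType) (m : nat) (A : 'M[R]_m) : R :=
  inf [set l | eigenvalue A l].

Definition indicator_ext (R : realType) (n : nat) (S : set 'cV[R]_n)
    (x : 'cV[R]_n) : \bar R :=
  if x \in S then 0%E else +oo%E.

Definition phi (R : realType) (N n : nat) (f : 'I_N -> 'cV[R]_n -> R)
    (Z : 'I_N -> set 'cV[R]_n) (i : 'I_N) (x : 'cV[R]_n) : \bar R :=
  ((f i x)%:E + indicator_ext (Z i) x)%E.

(* If h is not identically +oo, this is empty at the points where h is +oo. *)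
Definition subdiff (R : realType) (n : nat) (h : 'cV[R]_n -> \bar R)
    (x : 'cV[R]_n) : set 'cV[R]_n :=
  [set q | forall y, (h x + (dotv q (y - x))%:E <= h y)%E].

Definition stacked_subdiff (R : realType) (N n : nat)
    (f : 'I_N -> 'cV[R]_n -> R) (Z : 'I_N -> set 'cV[R]_n)
    (z : 'cV[R]_(N * n)) : set 'cV[R]_(N * n) :=
  [set q | forall i, subdiff (phi f Z i) (blk z i) (blk q i)].

Record proximal_tracking (R : realType) (N n : nat)
    (f : 'I_N -> 'cV[R]_n -> R) (Z : 'I_N -> set 'cV[R]_n) (w : 'M[R]_N) (c : R)
    (z g q : nat -> 'I_N -> 'cV[R]_n) : Prop := {
  tracking_init : forall i, [/\ z 0%N i = 0, g 0%N i = 0 & q 0%N i = 0];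
  tracking_step : forall k i,
    let xi := \sum_j w i j *: z k j in
    let iota := \sum_j w i j *: g k j in
    [/\ argmin (Z i) (fun x => f i x + dotv (iota - q k i) x
                                 + (2 * c)^-1 * enorm (x - xi) ^+ 2) (z k.+1 i),
        q k.+1 i = c^-1 *: (xi - z k.+1 i) + q k i - iota &
        g k.+1 i = iota + q k.+1 i - q k i] }.

Definition y_iter (R : realType) (N n : nat) (w : 'M[R]_N)
    (z : nat -> 'I_N -> 'cV[R]_n) (k : nat) : 'cV[R]_(N * n) :=
  \sum_(t < k.+1) (1%:M - kronI n w) *m stack (z t).

Definition x_iter (R : realType) (N n : nat) (w : 'M[R]_N)
    (z : nat -> 'I_N -> 'cV[R]_n) (k : nat) : 'cV[R]_(N * n) * 'cV[R]_(N * n) :=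
  (y_iter w z k, stack (z k)).

Definition metric_mx (R : realType) (m : nat) (W : 'M[R]_m) : 'M[R]_m :=
  2 *: W - W *m W.

Definition Fmap (R : realType) (N n : nat) (f : 'I_N -> 'cV[R]_n -> R)
    (Z : 'I_N -> set 'cV[R]_n) (w : 'M[R]_N) (c : R)
    (x : 'cV[R]_(N * n) * 'cV[R]_(N * n)) :
    set ('cV[R]_(N * n) * 'cV[R]_(N * n)) :=
  let W := kronI n w in
  [set (1%:M - W) *m x.2] `*`
  [set invmx (metric_mx W) *m (c *: q + (1%:M - W) *m x.1)
     | q in stacked_subdiff f Z x.2].

Definition Fzeros (R : realType) (N n : nat) (f : 'I_N -> 'cV[R]_n -> R)
    (Z : 'I_N -> set 'cV[R]_n) (w : 'M[R]_N) (c : R) :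
    set ('cV[R]_(N * n) * 'cV[R]_(N * n)) :=
  [set x | Fmap f Z w c x (0, 0)].

Definition normA2 (R : realType) (m : nat) (W : 'M[R]_m)
    (x : 'cV[R]_m * 'cV[R]_m) : R :=
  enorm x.1 ^+ 2 + dotv x.2 (metric_mx W *m x.2).

(* Squared distance. If S is nonempty and closed and metric_mx W is positive
   definite, the inf is attained; the value is 0 if S is empty. *)
Definition distA2 (R : realType) (m : nat) (W : 'M[R]_m)
    (x : 'cV[R]_m * 'cV[R]_m) (S : set ('cV[R]_m * 'cV[R]_m)) : R :=
  inf [set normA2 W (x.1 - x'.1, x.2 - x'.2) | x' in S].

Definition Qstar (R : realType) (N n : nat) (f : 'I_N -> 'cV[R]_n -> R)
    (Z : 'I_N -> set 'cV[R]_n) (w : 'M[R]_N) (zs : 'cV[R]_n) :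
    set 'cV[R]_(N * n) :=
  stacked_subdiff f Z (stack (fun _ => zs)) `&` mxrange (1%:M - kronI n w).

Definition calmness (R : realType) (N n : nat) (f : 'I_N -> 'cV[R]_n -> R)
    (Z : 'I_N -> set 'cV[R]_n) (w : 'M[R]_N) (zs : 'cV[R]_n)
    (ell rho : R) (delta : \bar R) : Prop :=
  forall z : 'cV[R]_(N * n), stacked_subdiff f Z z !=set0 ->
    ((enorm (z - stack (fun _ => zs)))%:E <= delta)%E ->
    forall q, stacked_subdiff f Z z q ->
      dist q (Qstar f Z w zs)
        <= ell * enorm (z - stack (fun _ => zs))
           + rho * dist q (mxrange (1%:M - kronI n w)).

(* Main.v *)
Require Import Defs.
From mathcomp Require Import complex spectral ring lra.

(** With L = I - W and M = 2W - W^2 = I - L^2, eliminating the tracking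
    variable g from the recursion gives
      c q^{k+1} = W^2 z^k - z^{k+1} - L y^k,   y^{k+1} = y^k + L z^{k+1}.
    This is not the proximal point iteration of F in the A-norm: the residual
    r = c q^{k+1} + L y^{k+1} equals W^2 z^k - M z^{k+1} and not
    M (z^k - z^{k+1}). For a zero xs = (ys, zs) of F with c qs + L ys = 0, and
    a = z^k - zs, b = z^{k+1} - zs, one finds nevertheless
      |x^k - xs|_A^2 - |x^{k+1} - xs|_A^2
        = 2c <q^{k+1} - qs, b> + <a, M a> - 2 <a, W^2 b> + <b, b>,
    and diagonalizing W shows that the quadratic form in (a, b) is at least
    (2 lambda - lambda^2) (|L z^{k+1}|^2 + |r|^2), lambda being the least
    eigenvalue of W. Strong convexity and calmness bound the squared distance
    of x^{k+1} to the zeros of F by kappa^2 (|L z^{k+1}|^2 + |r|^2), and the two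
    estimates give the contraction. By strong monotonicity the same identity
    makes |x^k - xs|_A^2 decrease by at least 2 c mu |b|^2, so that z^k
    converges to the stacked optimal solution. *)

Set Implicit Arguments.
Unset Strict Implicit.
Unset Printing Implicit Defensive.

Local Open Scope classical_set_scope.
Local Open Scope ring_scope.

(** * The Euclidean structure and the real spectral theorem *)

Lemma dotvE (R : realType) m (u v : 'cV[R]_m) : dotv u v = (u^T *m v) 0 0.
Proof. by rewrite mxE; apply: eq_bigr => i _; rewrite mxE. Qed.

Lemma dotvC (R : realType) m (u v : 'cV[R]_m) : dotv u v = dotv v u.
Proof. by apply: eq_bigr => i _; rewrite mulrC. Qed.

Lemma dotvDl (R : realType) m (u v x : 'cV[R]_m) :
  dotv (u + v) x = dotv u x + dotv v x.
Proof. by rewrite -big_split; apply: eq_bigr => i _; rewrite mxE mulrDl. Qed.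

Lemma dotvZl (R : realType) m a (u v : 'cV[R]_m) :
  dotv (a *: u) v = a * dotv u v.
Proof. by rewrite mulr_sumr; apply: eq_bigr => i _; rewrite mxE mulrA. Qed.

Lemma dotvDr (R : realType) m (x u v : 'cV[R]_m) :
  dotv x (u + v) = dotv x u + dotv x v.
Proof. by rewrite dotvC dotvDl !(dotvC x). Qed.

Lemma dotvZr (R : realType) m a (u v : 'cV[R]_m) :
  dotv u (a *: v) = a * dotv u v.
Proof. by rewrite dotvC dotvZl dotvC. Qed.

Lemma dotvNl (R : realType) m (u v : 'cV[R]_m) : dotv (- u) v = - dotv u v.
Proof. by rewrite -scaleN1r dotvZl mulN1r. Qed.

Lemma dotvNr (R : realType) m (u v : 'cV[R]_m) : dotv u (- v) = - dotv u v.
Proof. by rewrite dotvC dotvNl dotvC. Qed.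

Lemma dotv0r (R : realType) m (u : 'cV[R]_m) : dotv u 0 = 0.
Proof. by rewrite -(scale0r 0) dotvZr mul0r. Qed.

Lemma dotv_mulmx (R : realType) m (A : 'M[R]_m) (u v : 'cV[R]_m) :
  dotv (A *m u) v = dotv u (A^T *m v).
Proof. by rewrite !dotvE trmx_mul mulmxA. Qed.

Lemma dotvv_ge0 (R : realType) m (u : 'cV[R]_m) : 0 <= dotv u u.
Proof. by apply: sumr_ge0 => i _; rewrite -expr2 sqr_ge0. Qed.

Lemma dotvv_eq0 (R : realType) m (u : 'cV[R]_m) : (dotv u u == 0) = (u == 0).
Proof.
apply/idP/eqP => [|->]; last by rewrite dotv0r.
rewrite psumr_eq0 => [/allP u0|i _]; last by rewrite -expr2 sqr_ge0.
apply/colP => i; rewrite mxE; have := u0 i; rewrite mem_index_enum.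
by move=> /(_ isT); rewrite mulf_eq0 orbb => /eqP.
Qed.

Lemma dotvv_gt0 (R : realType) m (u : 'cV[R]_m) : (0 < dotv u u) = (u != 0).
Proof. by rewrite lt_def dotvv_ge0 dotvv_eq0 andbT. Qed.

Lemma sqr_enorm (R : realType) m (u : 'cV[R]_m) : enorm u ^+ 2 = dotv u u.
Proof. by rewrite sqr_sqrtr ?dotvv_ge0. Qed.

Lemma enorm_ge0 (R : realType) m (u : 'cV[R]_m) : 0 <= enorm u.
Proof. exact: sqrtr_ge0. Qed.

(** Cauchy-Schwarz: the squared length of [dotv v v *: u - dotv u v *: v] is nonnegative and equals
    [dotv v v] times the gap between the squares of the two sides. *)
Lemma dotv_le_enorm (R : realType) m (u v : 'cV[R]_m) :
  dotv u v <= enorm u * enorm v.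
Proof.
have [->|v0] := eqVneq v 0; first by rewrite dotv0r mulr_ge0 ?enorm_ge0.
have vv : 0 < dotv v v by rewrite dotvv_gt0.
apply: le_trans (ler_norm _) _.
rewrite -(@ler_pXn2r _ 2) ?nnegrE ?mulr_ge0 ?enorm_ge0 //.
rewrite real_normK ?num_real // exprMn !sqr_enorm.
have := dotvv_ge0 (dotv v v *: u - dotv u v *: v).
rewrite !(dotvDl, dotvDr, dotvNl, dotvNr, dotvZl, dotvZr) (dotvC v u) => h.
rewrite -subr_ge0 -(pmulr_rge0 _ vv); lra.
Qed.

Lemma enormD (R : realType) m (u v : 'cV[R]_m) :
  enorm (u + v) <= enorm u + enorm v.
Proof.
rewrite -(@ler_pXn2r _ 2) ?nnegrE ?addr_ge0 ?enorm_ge0 //.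
rewrite sqrrD !sqr_enorm !(dotvDl, dotvDr) (dotvC v u).
by have := dotv_le_enorm u v; lra.
Qed.

Lemma enormZ (R : realType) m a (u : 'cV[R]_m) :
  enorm (a *: u) = `|a| * enorm u.
Proof.
by rewrite /enorm dotvZl dotvZr mulrA -expr2 sqrtrM ?sqr_ge0 // sqrtr_sqr.
Qed.

Lemma enormN (R : realType) m (u : 'cV[R]_m) : enorm (- u) = enorm u.
Proof. by rewrite -scaleN1r enormZ normrN1 mul1r. Qed.

(** A complex eigenvector exists since the field is closed. Its real and imaginary parts [u] and [v]
    span a space stable under [A], and symmetry gives [Im a * (|u|^2 + |v|^2) = 0]; so [a] is real,
    and whichever of [u], [v] is nonzero is a real eigenvector. *)
Lemma symmetric_eigenvector (R : realType) m (A : 'M[R]_m) :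
  (0 < m)%N -> A^T = A -> exists l (v : 'cV[R]_m), v != 0 /\ A *m v = l *: v.
Proof.
move=> m0 symA.
have [a /eigenvalueP[x xA x0]] :=
  eigenvalue_closed (map_mx (real_complex R) A) m0.
pose u : 'cV[R]_m := \col_j complex.Re (x 0 j).
pose v : 'cV[R]_m := \col_j complex.Im (x 0 j).
have Axk k : \sum_j x 0 j * (A j k)%:C%C = a * x 0 k.
  move/rowP: xA => /(_ k); rewrite !mxE => <-.
  by apply: eq_bigr => j _; rewrite !mxE.
have Au : A *m u = complex.Re a *: u - complex.Im a *: v.
  apply/colP => k; rewrite !mxE.
  have /(congr1 (@complex.Re R)) := Axk k; rewrite raddf_sum /=.
  case: (a) (x 0 k) => [a1 a2] [x1 x2] /= <-.
  apply: eq_bigr => j _; rewrite !mxE -{1}symA mxE.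
  by case: (x 0 j) => y1 y2 /=; ring.
have Av : A *m v = complex.Im a *: u + complex.Re a *: v.
  apply/colP => k; rewrite !mxE.
  have /(congr1 (@complex.Im R)) := Axk k; rewrite raddf_sum /=.
  case: (a) (x 0 k) => [a1 a2] [x1 x2] /= e.
  rewrite addrC -e; apply: eq_bigr => j _; rewrite !mxE -{1}symA mxE.
  by case: (x 0 j) => y1 y2 /=; ring.
have uv0 : ~~ ((u == 0) && (v == 0)).
  apply: contra x0 => /andP[/eqP/colP u0 /eqP/colP v0].
  apply/eqP/rowP => j; move: (u0 j) (v0 j); rewrite !mxE.
  by case: (x 0 j) => ? ? /= -> ->.
have a0 : complex.Im a = 0.
  have : dotv (A *m v) u = dotv v (A *m u) by rewrite dotv_mulmx symA.
  rewrite Au Av !(dotvDl, dotvDr, dotvNl, dotvNr, dotvZl, dotvZr) => e.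
  have : complex.Im a * (dotv u u + dotv v v) = 0 by lra.
  move/eqP; rewrite mulf_eq0 => /orP[/eqP//|].
  by rewrite paddr_eq0 ?dotvv_ge0 // !dotvv_eq0 (negPf uv0).
exists (complex.Re a); move: uv0; rewrite negb_and => /orP[u0|v0].
  by exists u; rewrite Au a0 scale0r subr0.
by exists v; rewrite Av a0 scale0r add0r.
Qed.

(** The reflection in the hyperplane orthogonal to [p = u - v] works: equal lengths give
    [dotv p p = 2 * dotv p u], so that it subtracts exactly [p] from [u]. *)
Lemma householder (R : realType) m (u v : 'cV[R]_m) :
  dotv u u = dotv v v ->
  exists H : 'M[R]_m, [/\ H^T = H, H *m H = 1%:M & H *m u = v].
Proof.
move=> uv; have [->|] := eqVneq u v.
  by exists 1%:M; rewrite trmx1 !mul1mx.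
rewrite -subr_eq0; set p := u - v => p0.
have pp0 : dotv p p != 0 by rewrite dotvv_eq0.
have pTx (x : 'cV_m) : p^T *m x = (dotv p x)%:M.
  by apply/matrixP => i j; rewrite !ord1 -dotvE mxE.
exists (1%:M - (2 / dotv p p) *: (p *m p^T)); split.
- by rewrite linearB linearZ /= trmx1 trmx_mul trmxK.
- rewrite mulmxBl mul1mx mulmxBr mulmx1 -scalemxAl -scalemxAr.
  rewrite -mulmxA (mulmxA p^T) pTx mul_scalar_mx -scalemxAr !scalerA.
  rewrite opprD opprK addrA -[RHS]addr0 -!addrA; congr (_ + _).
  rewrite -!scaleNr -!scalerDl; set k := (X in X *: _).
  suff -> : k = 0 by rewrite scale0r.
  by rewrite /k /GRing.scale /=; field.
- rewrite mulmxBl mul1mx -scalemxAl -mulmxA pTx mul_mx_scalar scalerA.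
  have pp : dotv p p = 2 * dotv p u.
    rewrite /p !(dotvDl, dotvDr, dotvNl, dotvNr) (dotvC v u) uv; ring.
  suff -> : 2 / dotv p p * dotv p u = 1.
    by rewrite scale1r /p opprB addrC subrK.
  by rewrite mulrAC -pp divff.
Qed.

(** Deflation. A reflection [H] carries the first basis vector to a unit eigenvector, so the first
    column of [H A H], and by symmetry its first row, vanishes off the diagonal; the induction
    hypothesis diagonalizes the remaining block. *)
Theorem spectral_theorem (R : realType) m (A : 'M[R]_m) : A^T = A ->
  exists (P : 'M[R]_m) (d : 'rV[R]_m),
    P *m P^T = 1%:M /\ P *m A = diag_mx d *m P.
Proof.
elim: m A => [|m IHm] A symA.
  by exists 1%:M, 0; rewrite trmx1 mulmx1 !thinmx0; split; exact: flatmx0.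
have [l [v [v0 Av]]] := symmetric_eigenvector (ltn0Sn m) symA.
pose e : 'cV[R]_(1 + m) := delta_mx 0 0.
have ee : dotv e e = 1.
  by rewrite dotvE /e trmx_delta mul_delta_mx mxE.
have vv : 0 < dotv v v by rewrite dotvv_gt0.
have [|H [symH HH He]] := @householder R m.+1 e ((enorm v)^-1 *: v).
  rewrite ee dotvZl dotvZr -sqr_enorm mulrA -expr2 -exprMn.
  by rewrite mulVf ?expr1n ?sqrtr_eq0 -?ltNge.
have [B Bdef] : exists B : 'M[R]_(1 + m), B = H *m A *m H.
  by exists (H *m A *m H).
have symB : B^T = B by rewrite Bdef !trmx_mul symH symA mulmxA.
have Be : B *m e = l *: e.
  rewrite Bdef -!mulmxA He -scalemxAr Av scalerA mulrC -scalerA -scalemxAr -He.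
  by rewrite mulmxA HH mul1mx.
have Bl : lsubmx B = l *: e.
  rewrite -Be; apply/colP => i; rewrite !mxE (bigD1 0) //= big1 ?addr0.
    by rewrite mxE !eqxx mulr1; congr (B i _); apply/val_inj.
  by move=> j j0; rewrite mxE (negPf j0) mulr0.
have ul : ulsubmx B = l%:M.
  apply/matrixP => i j; rewrite !ord1 /ulsubmx.
  move/colP: Bl => /(_ (lshift m 0)).
  by rewrite !mxE /= => ->; rewrite mulr1.
have dl : dlsubmx B = 0.
  apply/matrixP => i j; rewrite !ord1 /dlsubmx.
  move/colP: Bl => /(_ (rshift 1 i)).
  by rewrite !mxE /= => ->; rewrite mulr0.
have ur : ursubmx B = 0 by rewrite -[LHS]trmxK trmx_ursub symB dl trmx0.
have [|P [d [PP PA]]] := IHm (drsubmx B); first by rewrite trmx_drsub symB.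
have defB : B = block_mx l%:M 0 0 (drsubmx B).
  by rewrite -[LHS]submxK ul ur dl.
pose Q : 'M[R]_(1 + m) := block_mx 1%:M 0 0 P.
have QQ : Q *m Q^T = 1%:M.
  rewrite /Q tr_block_mx trmx1 !trmx0 mulmx_block.
  by rewrite !mulmx0 !mul0mx !mulmx1 !addr0 add0r PP -scalar_mx_block.
have QB : Q *m B = diag_mx (row_mx l%:M d) *m Q.
  rewrite /Q {1}defB diag_mx_row !mulmx_block.
  rewrite !(mulmx0, mul0mx, mulmx1, mul1mx) !addr0 !add0r PA.
  by congr block_mx; apply/matrixP => i j; rewrite !ord1 !mxE.
have HA : H *m A = B *m H by rewrite Bdef -!mulmxA HH mulmx1.
exists (Q *m H), (row_mx l%:M d); split.
  rewrite trmx_mul symH mulmxA.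
  have -> : Q *m H *m H = Q by rewrite -mulmxA HH mulmx1.
  exact: QQ.
by rewrite -mulmxA HA !mulmxA QB.
Qed.

(** * Quadratic forms in a symmetric matrix with spectrum in (0, 1] *)

(** Identifying the spectrum with the values of [d] lets hypotheses on eigenvalues be applied
    coordinate by coordinate. *)
Lemma spectral_coordinates (R : realType) m (W : 'M[R]_m) : W^T = W ->
  exists (P : 'M[R]_m) (d : 'I_m -> R),
  [/\ P \in unitmx,
      forall u v : 'cV_m, dotv u v = \sum_i (P *m u) i 0 * (P *m v) i 0,
      forall (u : 'cV_m) i, (P *m (W *m u)) i 0 = d i * (P *m u) i 0 &
      forall l, eigenvalue W l <-> exists i, l = d i].
Proof.
move=> symW; have [P [d [PP PW]]] := spectral_theorem symW.
have [PU _] := mulmx1_unit PP.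
have PP' : P^T *m P = 1%:M by rewrite (mulmx1C PP).
have PWu (u : 'cV_m) i : (P *m (W *m u)) i 0 = d 0 i * (P *m u) i 0.
  by rewrite mulmxA PW -mulmxA mul_diag_mx mxE.
exists P, (fun i => d 0 i); split => //.
  move=> u v; rewrite -[RHS]/(dotv _ _).
  by rewrite dotv_mulmx mulmxA PP' mul1mx.
move=> l; split=> [/eigenvalueP[v vW v0]|[i ->]].
  have Wv : W *m v^T = l *: v^T by rewrite -{1}symW -trmx_mul vW linearZ.
  have : P *m v^T != 0.
    apply: contra v0 => /eqP Pv0; rewrite -trmx_eq0.
    by rewrite -(mulKmx PU v^T) Pv0 mulmx0.
  case/matrix0Pn => i [j]; rewrite ord1 => Pv0; exists i.
  have := PWu v^T i; rewrite Wv -scalemxAr mxE => /eqP.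
  by rewrite -subr_eq0 -mulrBl mulf_eq0 (negPf Pv0) orbF subr_eq0 => /eqP.
apply/eigenvalueP; exists (row i P).
  rewrite -row_mul PW; apply/rowP => j.
  by rewrite mxE mul_diag_mx !mxE.
apply/eqP => P0; have := congr1 (fun A : 'M[R]_m => A i i) PP.
rewrite !mxE eqxx big1 => [/esym/eqP|j _]; first by rewrite oner_eq0.
by move/rowP: P0 => /(_ j); rewrite !mxE => ->; rewrite mul0r.
Qed.

(* For [m0 = 2w - w^2] the difference of the two sides is a combination of
   [a^2], [b^2] and [(a - (1 - w) b)^2] with weights nonnegative on [0, 1]. *)
Lemma scalar_descent (R : realType) (w m0 a b : R) :
  0 <= w <= 1 -> m0 <= 2 * w - w ^+ 2 ->
  m0 * (((1 - w) * b) ^+ 2 + (w ^+ 2 * a - (2 * w - w ^+ 2) * b) ^+ 2)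
    <= (2 * w - w ^+ 2) * a ^+ 2 - 2 * (w ^+ 2 * (a * b)) + b ^+ 2.
Proof.
move=> /andP[w0 w1] m0w.
apply: le_trans (ler_wpM2r _ m0w) _; first by rewrite addr_ge0 ?sqr_ge0.
(* [t] is the matching eigenvalue of [I - W], and [2 * w - w ^+ 2 = 1 - t ^+ 2]. *)
have [t tE] : exists t, t = 1 - w by exists (1 - w).
have wE : w = 1 - t by rewrite tE; ring.
have t0 : 0 <= t by rewrite tE subr_ge0.
have t1 : t <= 1 by rewrite tE; lra.
have tt : t ^+ 2 <= 1 by rewrite expr_le1.
pose ca := w * t * ((1 + t) * (1 + w) * (1 + w ^+ 2) - w * (2 - t ^+ 2)).
pose cb := t ^+ 2 * (1 + (1 - t ^+ 2) ^+ 2 - w * t * (w * (2 - t ^+ 2))).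
pose cm := w ^+ 2 * t * (2 - t ^+ 2).
have ca0 : 0 <= ca.
  rewrite /ca mulr_ge0 ?mulr_ge0 // subr_ge0.
  have : 1 * (1 + w) * 1 <= (1 + t) * (1 + w) * (1 + w ^+ 2).
    by rewrite !ler_pM ?mulr_ge0 ?addr_ge0 ?lerDl ?sqr_ge0 //; lra.
  have : w * (2 - t ^+ 2) <= w * 2.
    by apply: ler_wpM2l => //; rewrite gerBl sqr_ge0.
  lra.
have cb0 : 0 <= cb.
  rewrite /cb mulr_ge0 ?sqr_ge0 // subr_ge0.
  have h1 : 0 <= (1 - t ^+ 2) ^+ 2 by rewrite sqr_ge0.
  have h2 : w * (2 - t ^+ 2) <= 1 * 2.
    by rewrite ler_pM ?gerBl ?sqr_ge0 //; lra.
  have h3 : w * t <= 4^-1.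
    have := sqr_ge0 (t - 2^-1); rewrite wE; lra.
  have : (w * t) * (w * (2 - t ^+ 2)) <= 4^-1 * (1 * 2).
    by rewrite ler_pM ?mulr_ge0 //; lra.
  lra.
have cm0 : 0 <= cm by rewrite /cm !mulr_ge0 ?sqr_ge0 //; lra.
rewrite -subr_ge0.
have -> : (2 * w - w ^+ 2) * a ^+ 2 - 2 * (w ^+ 2 * (a * b)) + b ^+ 2 -
   (2 * w - w ^+ 2) *
   (((1 - w) * b) ^+ 2 + (w ^+ 2 * a - (2 * w - w ^+ 2) * b) ^+ 2) =
   ca * a ^+ 2 + cb * b ^+ 2 + cm * (a - t * b) ^+ 2.
  by rewrite /ca /cb /cm wE; ring.
by do ![apply: addr_ge0]; rewrite mulr_ge0 ?sqr_ge0.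
Qed.

Lemma mulmx_metric (R : realType) m (W : 'M[R]_m) (v : 'cV[R]_m) :
  metric_mx W *m v = 2 *: (W *m v) - W *m (W *m v).
Proof. by rewrite mulmxBl -scalemxAl mulmxA. Qed.

Lemma mulmx_laplacian (R : realType) m (W : 'M[R]_m) (v : 'cV[R]_m) :
  (1%:M - W) *m v = v - W *m v.
Proof. by rewrite mulmxBl mul1mx. Qed.

Lemma mulmxBE (R : realType) m (P : 'M[R]_m) (u v : 'cV[R]_m) i :
  (P *m (u - v)) i 0 = (P *m u) i 0 - (P *m v) i 0.
Proof. by rewrite mulmxBr [LHS]mxE [X in _ + X]mxE. Qed.

Lemma mulmxZE (R : realType) m (P : 'M[R]_m) a (u : 'cV[R]_m) i :
  (P *m (a *: u)) i 0 = a * (P *m u) i 0.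
Proof. by rewrite -scalemxAr [LHS]mxE. Qed.

Section Spectral.
Variables (R : realType) (m : nat) (W : 'M[R]_m).
Hypothesis symW : W^T = W.
Hypothesis specW : forall l, eigenvalue W l -> 0 < l <= 1.

Let M := metric_mx W.
Let L := 1%:M - W.

(** In spectral coordinates both sides are sums over the eigenvalues [d i], and [scalar_descent]
    compares them term by term. *)
Lemma matrix_descent (lam : R) (a b : 'cV[R]_m) :
  (forall l, eigenvalue W l -> lam <= l) ->
  (2 * lam - lam ^+ 2) *
    (enorm (L *m b) ^+ 2 + enorm (W *m (W *m a) - M *m b) ^+ 2)
  <= dotv a (M *m a) - 2 * dotv a (W *m (W *m b)) + dotv b b.
Proof.
move=> lamW; have [P [d [_ Pdot PW Pd]]] := spectral_coordinates symW.
rewrite !sqr_enorm !Pdot -big_split !mulr_sumr -sumrB -big_split /=.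
apply: ler_sum => i _.
have di : eigenvalue W (d i) by apply/Pd; exists i.
have [/andP[d0 d1] ld] := (specW di, lamW _ di).
have PM (v : 'cV_m) : (P *m (M *m v)) i 0 =
    (2 * d i - d i ^+ 2) * (P *m v) i 0.
  by rewrite mulmx_metric mulmxBE mulmxZE !PW; ring.
have PL (v : 'cV_m) : (P *m (L *m v)) i 0 = (1 - d i) * (P *m v) i 0.
  by rewrite mulmx_laplacian mulmxBE PW; ring.
rewrite mulmxBE !PL !PM !PW.
have := @scalar_descent R (d i) (2 * lam - lam ^+ 2)
  ((P *m a) i 0) ((P *m b) i 0).
set x := (P *m a) i 0; set y := (P *m b) i 0 => sd.
apply: le_trans (_ : _ <= _) (le_trans (sd _ _) _); last 3 first.
- by rewrite (ltW d0).
(* This product is the increase of [2 * x - x ^+ 2] from [lam] to [d i]. *)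
- have : 0 <= (d i - lam) * (2 - d i - lam) by rewrite mulr_ge0 //; lra.
  by lra.
- by rewrite le_eqVlt; apply/orP; left; apply/eqP; ring.
- by rewrite le_eqVlt; apply/orP; left; apply/eqP; ring.
Qed.

Lemma metric_ge0 (v : 'cV[R]_m) : 0 <= dotv v (M *m v).
Proof.
have := @matrix_descent 0 v 0; rewrite !mulmx0 !dotv0r mulr0 expr0n subr0.
by rewrite mul0r subr0 addr0; apply=> l /specW/andP[/ltW].
Qed.

(** This is [M = I - L^2] with [L] symmetric. *)
Lemma metric_le_sqr_enorm (v : 'cV[R]_m) : dotv v (M *m v) <= enorm v ^+ 2.
Proof.
suff : dotv v (M *m v) = enorm v ^+ 2 - enorm (L *m v) ^+ 2.
  by move=> ->; rewrite gerBl sqr_ge0.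
rewrite !sqr_enorm mulmx_metric mulmx_laplacian.
rewrite !(dotvDl, dotvDr, dotvNl, dotvNr, dotvZl, dotvZr).
by rewrite !dotv_mulmx symW; ring.
Qed.

(** The eigenvalues of [M] are [d i * (2 - d i)], which are positive for [d i] in (0, 1]. *)
Lemma metric_unitmx : M \in unitmx.
Proof.
have [P [d [PU Pdot PW Pd]]] := spectral_coordinates symW.
rewrite -unitmx_tr -row_free_unit -kermx_eq0.
apply/rowV0P => u /sub_kermxP uM.
have Mu : M *m u^T = 0 by rewrite -[M]trmxK -trmx_mul uM trmx0.
suff /eqP : P *m u^T = 0.
  move/eqP => Pu; apply: trmx_inj.
  by rewrite -(mulKmx PU u^T) Pu mulmx0 trmx0.
apply/colP => i; rewrite [RHS]mxE.
have := congr1 (fun v : 'cV_m => (P *m v) i 0) Mu.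
rewrite /= mulmx_metric mulmxBE mulmxZE mulmx0 !PW [RHS]mxE.
have /specW/andP[d0 d1] : eigenvalue W (d i) by apply/Pd; exists i.
move=> h; have /eqP : d i * (2 - d i) * (P *m u^T) i 0 = 0 by rewrite -h; ring.
rewrite !mulf_eq0 (gt_eqF d0) orFb (_ : 2 - d i == 0 = false) => [/eqP//|].
by apply/gt_eqF; lra.
Qed.

(* [y'] is the translate of [v] by the component of [y - v] in the kernel. *)
Lemma laplacian_error_bound (s : R) (y v : 'cV[R]_m) : 0 < s ->
  (forall l, eigenvalue W l -> l < 1 -> l <= 1 - s) ->
  exists y' : 'cV[R]_m,
    L *m y' = L *m v /\ s * enorm (y - y') <= enorm (L *m (y - v)).
Proof.
move=> s0 gap; have [P [d [PU Pdot PW Pd]]] := spectral_coordinates symW.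
have PL (x : 'cV_m) i : (P *m (L *m x)) i 0 = (1 - d i) * (P *m x) i 0.
  by rewrite mulmx_laplacian mulmxBE PW; ring.
pose k : 'cV[R]_m := \col_i (if d i == 1 then (P *m (y - v)) i 0 else 0).
exists (v + invmx P *m k).
have Pk i : (P *m (invmx P *m k)) i 0 =
    if d i == 1 then (P *m (y - v)) i 0 else 0.
  by rewrite mulKVmx // mxE.
split.
  suff : L *m (invmx P *m k) = 0 by rewrite mulmxDr => ->; rewrite addr0.
  rewrite -[LHS](mulKmx PU); suff -> : P *m (L *m (invmx P *m k)) = 0.
    by rewrite mulmx0.
  apply/colP => i; rewrite PL Pk [RHS]mxE.
  by case: eqP => [->|]; rewrite ?subrr ?mul0r ?mulr0.
rewrite -(@ler_pXn2r _ 2) ?nnegrE ?mulr_ge0 ?enorm_ge0 ?(ltW s0) //.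
rewrite exprMn !sqr_enorm !Pdot mulr_sumr; apply: ler_sum => i _.
rewrite PL opprD addrA (mulmxBE P (y - v)) Pk.
have di : eigenvalue W (d i) by apply/Pd; exists i.
have /andP[d0 d1] := specW di.
case: eqP => [->|/eqP dn1].
  by rewrite !subrr !mul0r mulr0.
rewrite subr0 -!expr2 exprMn ler_wpM2r ?sqr_ge0 //.
rewrite ler_pXn2r ?nnegrE ?subr_ge0 ?(ltW s0) //.
by have := gap _ di; rewrite lt_neqAle dn1 d1 => /(_ isT); lra.
Qed.

End Spectral.

(** * Stacked vectors and the network matrix *)

Lemma blk_stack (R : realType) N n (v : 'I_N -> 'cV[R]_n) i :
  blk (stack v) i = v i.
Proof. by apply/colP => j; rewrite !mxE mxtens_indexK. Qed.

Lemma blk_inj (R : realType) N n (x y : 'cV[R]_(N * n)) :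
  (forall i, blk x i = blk y i) -> x = y.
Proof.
move=> xy; apply/colP => k; case: (mxtens_indexP k) => i j.
by have /colP/(_ j) := xy i; rewrite !mxE.
Qed.

Lemma blkD (R : realType) N n (x y : 'cV[R]_(N * n)) i :
  blk (x + y) i = blk x i + blk y i.
Proof. by apply/colP => j; rewrite !mxE. Qed.

Lemma blkB (R : realType) N n (x y : 'cV[R]_(N * n)) i :
  blk (x - y) i = blk x i - blk y i.
Proof. by apply/colP => j; rewrite !mxE. Qed.

Lemma blkZ (R : realType) N n a (x : 'cV[R]_(N * n)) i :
  blk (a *: x) i = a *: blk x i.
Proof. by apply/colP => j; rewrite !mxE. Qed.

Lemma big_mxtens (R : realType) N n (F : 'I_(N * n) -> R) :
  \sum_k F k = \sum_i \sum_j F (mxtens_index (i, j)).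
Proof.
rewrite pair_big (reindex (@mxtens_index N n)) /=.
  by apply: eq_bigr => -[].
by exists (@mxtens_unindex N n) => k _; rewrite ?mxtens_indexK ?mxtens_unindexK.
Qed.

Lemma dotv_blk (R : realType) N n (x y : 'cV[R]_(N * n)) :
  dotv x y = \sum_i dotv (blk x i) (blk y i).
Proof.
rewrite /dotv big_mxtens; apply: eq_bigr => i _.
by apply: eq_bigr => j _; rewrite !mxE.
Qed.

Lemma blk_kronI (R : realType) N n (w : 'M[R]_N) (x : 'cV[R]_(N * n)) i :
  blk (kronI n w *m x) i = \sum_j w i j *: blk x j.
Proof.
apply/colP => j; rewrite [LHS]mxE [LHS]mxE big_mxtens summxE.
apply: eq_bigr => i' _; rewrite (bigD1 j) //= big1 => [|j' j'j].
  by rewrite tensmxE [X in _ * X * _]mxE eqxx mulr1 addr0 !mxE.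
by rewrite tensmxE [X in _ * X * _]mxE eq_sym (negPf j'j) mulr0 mul0r.
Qed.

Lemma kronI_sym (R : realType) N n (w : 'M[R]_N) :
  w^T = w -> (kronI n w)^T = kronI n w.
Proof. by move=> symw; rewrite /kronI trmx_tens symw trmx1. Qed.

Lemma eigenvalue_sym (R : realType) m (W : 'M[R]_m) l : W^T = W ->
  (exists2 v : 'cV[R]_m, W *m v = l *: v & v != 0) <-> eigenvalue W l.
Proof.
move=> symW; split=> [[v Wv v0]|/eigenvalueP[v vW v0]].
  apply/eigenvalueP; exists v^T; last by rewrite trmx_eq0.
  by rewrite -{1}symW -trmx_mul Wv linearZ.
exists v^T; last by rewrite trmx_eq0.
by rewrite -{1}symW -trmx_mul vW linearZ.
Qed.

(** Since [kronI n w] acts on each coordinate [j] of the blocks separately, any nonzero slice of an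
    eigenvector along a fixed [j] is an eigenvector of [w]. *)
Lemma eigenvalue_kronI (R : realType) N n (w : 'M[R]_N) l :
  w^T = w -> eigenvalue (kronI n w) l -> eigenvalue w l.
Proof.
move=> symw /(eigenvalue_sym _ (kronI_sym n symw))[v Wv v0].
have /matrix0Pn[k [j]] := v0; rewrite ord1.
case: (mxtens_indexP k) => i {}j vij.
apply/(eigenvalue_sym _ symw); exists (\col_i v (mxtens_index (i, j)) 0).
  apply/colP => i'; have := blk_kronI w v i'; rewrite Wv blkZ => /colP/(_ j).
  rewrite !mxE summxE => ->; apply: eq_bigr => i'' _.
  by rewrite !mxE.
by apply/matrix0Pn; exists i, 0; rewrite mxE.
Qed.

(** * Spectrum of the weight matrix *)

Section Network.
Variables (R : realType) (N : nat) (E : rel 'I_N) (w : 'M[R]_N).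
Hypothesis net : network E w.

Lemma network_weight_ge0 i j : 0 <= w i j.
Proof.
by have [/(weight_edge net)/ltW|/(weight_nonedge net)->] := boolP (E i j).
Qed.

(** The Dirichlet form of the weighted graph. Its nonnegativity is what bounds the eigenvalues of
    [w] by 1. *)
Lemma network_dirichlet (u : 'cV[R]_N) :
  \sum_i \sum_j w i j * (u i 0 - u j 0) ^+ 2
    = 2 * (dotv u u - dotv u (w *m u)).
Proof.
have h1 : \sum_i \sum_j w i j * u i 0 ^+ 2 = dotv u u.
  by apply: eq_bigr => i _; rewrite -mulr_suml (weight_row_sum net) mul1r.
have h2 : \sum_i \sum_j w i j * u j 0 ^+ 2 = dotv u u.
  rewrite exchange_big; apply: eq_bigr => j _.
  by rewrite -mulr_suml (weight_col_sum net) mul1r.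
have h3 : \sum_i \sum_j w i j * (u i 0 * u j 0) = dotv u (w *m u).
  apply: eq_bigr => i _; rewrite mxE mulr_sumr; apply: eq_bigr => j _; ring.
transitivity (dotv u u + dotv u u - 2 * dotv u (w *m u)); last by ring.
rewrite -{1}h1 -h2 -h3 mulr_sumr -big_split -sumrB; apply: eq_bigr => i _.
rewrite mulr_sumr -big_split -sumrB; apply: eq_bigr => j _ /=; ring.
Qed.

Lemma network_eigenvalue l : eigenvalue w l -> 0 < l <= 1.
Proof.
move=> /(eigenvalue_sym _ (weight_sym net))[v wv v0].
have vv : 0 < dotv v v by rewrite dotvv_gt0.
have := weight_posdef net v0; have := network_dirichlet v.
rewrite wv dotvZr pmulr_lgt0 // => h ->; rewrite andTb.
have : 0 <= 2 * (dotv v v - l * dotv v v).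
  rewrite -h; apply: sumr_ge0 => i _; apply: sumr_ge0 => j _.
  by rewrite mulr_ge0 ?sqr_ge0 ?network_weight_ge0.
by rewrite pmulr_rge0 ?ltr0n // subr_ge0 ger_pMl.
Qed.

Lemma kronI_eigenvalue n l : eigenvalue (kronI n w) l -> 0 < l <= 1.
Proof. by move=> /(eigenvalue_kronI (weight_sym net))/network_eigenvalue. Qed.

Lemma kronI_consensus n (v : 'cV[R]_n) :
  kronI n w *m stack (fun _ => v) = stack (fun _ => v).
Proof.
apply: blk_inj => i; rewrite blk_kronI blk_stack.
under eq_bigr do rewrite blk_stack.
by rewrite -scaler_suml (weight_row_sum net) scale1r.
Qed.

Lemma le_spectral_gap l : eigenvalue w l -> l < 1 -> l <= 1 - spectral_gap w.
Proof.
move=> wl l1; rewrite /spectral_gap opprB addrC subrK.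
by apply: ub_le_sup; [exists 1 => x [_ /ltW]|split].
Qed.

(** The eigenvalues below 1 are among finitely many [d i], so their supremum is at most a finite
    maximum of numbers below 1. For an empty set [sup] is 0 and the gap is 1. *)
Lemma spectral_gap_gt0 : 0 < spectral_gap w.
Proof.
rewrite subr_gt0; set S := [set l | _].
have [->|/set0P S0] := eqVneq S set0; first by rewrite sup0.
have [P [d [_ _ _ wd]]] := spectral_coordinates (weight_sym net).
apply: (@le_lt_trans _ _ (\big[Num.max/0]_(i | d i < 1) d i)).
  apply: ge_sup => // l [/wd[i ->] di1].
  exact: le_bigmax_cond.
by apply/bigmax_ltP; split.
Qed.

Lemma kronI_lambda_min n l :
  eigenvalue (kronI n w) l -> lambda_min (kronI n w) <= l.
Proof.
by move=> Wl; apply: ge_inf => //; exists 0 => x /kronI_eigenvalue/andP[/ltW].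
Qed.

Lemma kronI_lambda_min_bounds n :
  (0 < N)%N -> (0 < n)%N -> 0 <= lambda_min (kronI n w) <= 1.
Proof.
move=> N0 n0.
have [P [d [_ _ _ Wd]]] := spectral_coordinates (kronI_sym n (weight_sym net)).
pose i0 := mxtens_index (Ordinal N0, Ordinal n0).
have Wi0 : eigenvalue (kronI n w) (d i0) by apply/Wd; exists i0.
apply/andP; split.
  apply: lb_le_inf; first by exists (d i0).
  by move=> x /kronI_eigenvalue/andP[/ltW].
apply: le_trans (kronI_lambda_min Wi0) _.
by have /andP[] := kronI_eigenvalue Wi0.
Qed.

End Network.

(** * Subdifferentials of strongly convex functions *)

Lemma convex_setE (R : realType) n (S : set 'cV[R]_n) x y (t : R) :
  convex_set S -> S x -> S y -> 0 <= t <= 1 -> S (t *: x + (1 - t) *: y).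
Proof.
move=> cS /mem_set Sx /mem_set Sy /andP[t0 t1]; apply: set_mem.
exact: (cS x y (Itv01 t0 t1) Sx Sy).
Qed.

Lemma le_infinitesimal (R : realType) (a b k : R) :
  (forall t, 0 < t <= 1 -> a <= b + t * k) -> a <= b.
Proof.
move=> h; apply/ler_addgt0Pr => e e0.
have k0 : 0 < `|k| + 1 by rewrite ltr_wpDl.
(* This choice makes [t * k] at most [e] while keeping [t] in (0, 1]. *)
pose t := Num.min 1 (e / (`|k| + 1)).
have t0 : 0 < t by rewrite lt_min ltr01 divr_gt0.
apply: le_trans (h t _) _; first by rewrite t0 ge_min lexx.
rewrite lerD2l; apply: le_trans (ler_wpM2l (ltW t0) (ler_norm k)) _.
apply: le_trans (_ : e / (`|k| + 1) * `|k| <= _).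
  by rewrite ler_wpM2r // ge_min lexx orbT.
by rewrite mulrAC ler_pdivrMr // ler_wpM2l ?lerDl // ltW.
Qed.

Section Subdifferential.
Variables (R : realType) (N n : nat).
Variables (f : 'I_N -> 'cV[R]_n -> R) (Z : 'I_N -> set 'cV[R]_n).
Implicit Types x y p q : 'cV[R]_n.

(** The point [x0] makes [phi] finite somewhere, which rules out subgradients at points outside
    [Z i]. *)
Lemma subdiff_phiP i x0 x q : Z i x0 ->
  subdiff (phi f Z i) x q <->
  Z i x /\ forall y, Z i y -> f i x + dotv q (y - x) <= f i y.
Proof.
move=> Z0; have phiE y : Z i y -> phi f Z i y = (f i y)%:E.
  by move=> Zy; rewrite /phi /indicator_ext mem_set // adde0.
have phiN y : ~ Z i y -> phi f Z i y = +oo%E.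
  by move=> Zy; rewrite /phi /indicator_ext memNset.
split=> [h|[Zx h] y].
  have Zx : Z i x.
    apply: contrapT => Zx; have := h x0.
    by rewrite (phiN _ Zx) (phiE _ Z0).
  split=> // y Zy; have := h y.
  by rewrite !phiE // -EFinD lee_fin.
have [Zy|Zy] := pselect (Z i y); last by rewrite (phiN _ Zy) leey.
by rewrite !phiE // -EFinD lee_fin; apply: h.
Qed.

Variables (i : 'I_N) (mu : R).
Hypothesis Zconvex : convex_set (Z i).
Hypothesis fstrong : strongly_convex mu (f i).

(** The subgradient inequality at [x + t (y - x)] is combined with strong convexity along the
    segment, divided by [t], and [t] tends to 0. *)
Lemma subdiff_strong x y q : subdiff (phi f Z i) x q -> Z i y ->
  f i x + dotv q (y - x) + mu / 2 * enorm (y - x) ^+ 2 <= f i y.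
Proof.
move=> qx Zy; have [Zx h] := (subdiff_phiP x q Zy).1 qx.
apply: (@le_infinitesimal _ _ _ (mu / 2 * enorm (y - x) ^+ 2)) => t.
move=> /andP[t0 t1].
have tI : 0 <= t <= 1 by rewrite (ltW t0).
have := le_trans (h _ (convex_setE Zconvex Zy Zx tI)) (fstrong y x tI).
have -> : t *: y + (1 - t) *: x - x = t *: (y - x).
  by rewrite scalerBl scale1r addrAC addrA subrK scalerBr.
rewrite dotvZr -subr_ge0 => ht; rewrite -subr_ge0 -(pmulr_rge0 _ t0).
lra.
Qed.

Lemma subdiff_strongly_monotone x y p q :
  subdiff (phi f Z i) x p -> subdiff (phi f Z i) y q -> Z i y ->
  mu * enorm (x - y) ^+ 2 <= dotv (p - q) (x - y).
Proof.
move=> px qy Zy; have [Zx _] := (subdiff_phiP x p Zy).1 px.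
have := subdiff_strong px Zy; have := subdiff_strong qy Zx.
rewrite -(opprB x y) enormN dotvNr dotvDl dotvNl => h1 h2; lra.
Qed.

(** Takes the place of a sum rule for subdifferentials: when the minimizer [x] is compared with
    [x + t (y - x)], the quadratic term is linear in [t] up to order [t^2], and its linear part
    becomes the subgradient as [t] tends to 0. *)
Lemma prox_subdiff x xi p c : 0 <= mu -> 0 < c ->
  argmin (Z i)
    (fun x => f i x + dotv p x + (2 * c)^-1 * enorm (x - xi) ^+ 2) x ->
  subdiff (phi f Z i) x (c^-1 *: (xi - x) - p).
Proof.
move=> mu0 c0 [Zx xmin]; apply/(subdiff_phiP _ _ Zx); split=> // y Zy.
apply: (@le_infinitesimal _ _ _ ((2 * c)^-1 * enorm (y - x) ^+ 2)) => t.
move=> /andP[t0 t1].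
have tI : 0 <= t <= 1 by rewrite (ltW t0).
have := xmin _ (convex_setE Zconvex Zy Zx tI).
have := fstrong y x tI.
have : 0 <= mu / 2 * t * (1 - t) * enorm (y - x) ^+ 2.
  by rewrite mulr_ge0 ?sqr_ge0 // !mulr_ge0 ?subr_ge0 ?invr_ge0 // ltW.
have -> : t *: y + (1 - t) *: x = x + t *: (y - x).
  by rewrite scalerBl scale1r addrCA scalerBr.
move=> h0 h1 h2; rewrite -subr_ge0 -(pmulr_rge0 _ t0).
move: h2; rewrite -(addrAC x) !sqr_enorm.
rewrite !(dotvDl, dotvDr, dotvNl, dotvNr, dotvZl, dotvZr).
rewrite (dotvC y x) (dotvC xi x) (dotvC xi y) invfM.
lra.
Qed.

End Subdifferential.

(** * One step of the recursion in the A-norm *)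

Section OneStep.
Variables (R : realType) (m : nat) (W : 'M[R]_m).
Hypothesis symW : W^T = W.
Hypothesis specW : forall l, eigenvalue W l -> 0 < l <= 1.

Let L : 'M[R]_m := 1%:M - W.

Lemma normA2_ge0 x : 0 <= normA2 W x.
Proof. by rewrite addr_ge0 ?sqr_ge0 ?metric_ge0. Qed.

(** Everything is written in the errors [a], [b], [e], using [L zs = 0]. The cross terms between [e]
    and [L b] cancel, and the only inequality used is [matrix_descent]. *)
Lemma one_step (lam c : R) (y z y' z' q' ys zs qs : 'cV[R]_m) :
  (forall l, eigenvalue W l -> lam <= l) ->
  W *m zs = zs -> c *: qs + L *m ys = 0 ->
  c *: q' = W *m (W *m z) - z' - L *m y -> y' = y + L *m z' ->
  normA2 W (y' - ys, z' - zs) + 2 * c * dotv (q' - qs) (z' - zs)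
    + (2 * lam - lam ^+ 2) *
        (enorm (L *m z') ^+ 2 + enorm (c *: q' + L *m y') ^+ 2)
  <= normA2 W (y - ys, z - zs).
Proof.
move=> lamW Wzs Lys q'E y'E.
have [a aE] : exists a : 'cV[R]_m, a = z - zs by exists (z - zs).
have [b bE] : exists b : 'cV[R]_m, b = z' - zs by exists (z' - zs).
have [e eE] : exists e : 'cV[R]_m, e = y - ys by exists (y - ys).
have Lb : L *m b = L *m z'.
  by rewrite bE /L !mulmx_laplacian mulmxBr Wzs opprB addrA subrK.
have rE : c *: q' + L *m y' = W *m (W *m a) - metric_mx W *m b.
  rewrite q'E y'E aE bE mulmxDr addrA subrK mulmx_metric /L !mulmx_laplacian.
  rewrite !mulmxBr !Wzs.
  move: (W *m (W *m z)) (W *m (W *m z')) (W *m z') => v1 v2 v3.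
  by apply/colP => i; rewrite !mxE; ring.
have dqE : c *: (q' - qs) = W *m (W *m a) - b - L *m e.
  have cqs : c *: qs = - (L *m ys) by apply/eqP; rewrite -addr_eq0 Lys.
  rewrite scalerBr cqs q'E aE bE eE !mulmxBr !Wzs.
  move: (W *m (W *m z)) (L *m y) (L *m ys) => v1 v2 v3.
  by apply/colP => i; rewrite !mxE; ring.
have dyE : y' - ys = e + L *m b by rewrite y'E Lb eE addrAC.
have dqb : 2 * c * dotv (q' - qs) b = 2 * dotv (W *m (W *m a) - b - L *m e) b.
  by rewrite -mulrA -dotvZl dqE.
set D := _ * (_ + _); have : D <= dotv a (metric_mx W *m a)
    - 2 * dotv a (W *m (W *m b)) + dotv b b.
  by rewrite /D rE -Lb; exact: matrix_descent.
move: D => D; rewrite dyE -bE -aE -eE dqb /normA2 /=.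
have bWe : dotv b (W *m e) = dotv e (W *m b) by rewrite dotvC dotv_mulmx symW.
rewrite !sqr_enorm !mulmx_metric /L !mulmx_laplacian.
rewrite !(dotvDl, dotvDr, dotvNl, dotvNr, dotvZl, dotvZr, dotv_mulmx, symW).
rewrite !mulmxN !(dotvDr, dotvNr) bWe (dotvC b e). lra.
Qed.

End OneStep.

(** * Error bound and iteration *)

(** If [a > p + k], then [a > k] and [a^2 > (p + k) a >= p a + k^2]. *)
Lemma quadratic_root_bound (R : realType) (a p k : R) :
  0 <= p -> 0 <= k -> a ^+ 2 <= p * a + k ^+ 2 -> a <= p + k.
Proof.
move=> p0 k0 h; rewrite leNgt; apply/negP => pka.
have a0 : 0 < a by apply: le_lt_trans pka; rewrite addr_ge0.
have : (p + k) * a < a * a by rewrite ltr_pM2r.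
have : k * k <= k * a by rewrite ler_wpM2l //; lra.
rewrite !expr2 in h; lra.
Qed.

(** The origin of [C] and [kappa]. With [T^2 = s^2 + r^2] the first inequality is quadratic in [a]
    and yields [a <= C * T]; then [beta] is at most the second entry of [kappa] times [T], and the
    squares add up. *)
Lemma residual_bound (R : realType) (c mu sigma ell rho r s a d : R) :
  0 < c -> 0 < mu -> 0 < sigma -> 0 <= ell -> 0 <= rho ->
  0 <= r -> 0 <= s -> 0 <= a ->
  let beta := ((1 + rho) * r + c * ell * a) / sigma in
  let C := 1 / (c * mu) + ell / (mu * sigma)
           + Num.sqrt ((1 + rho) / (2 * sigma * c * mu)) in
  let kappa := Num.sqrt (C ^+ 2 + ((1 + rho + c * ell * C) / sigma) ^+ 2) in
  c * mu * a ^+ 2 <= r * a + beta * s -> d <= beta ^+ 2 + a ^+ 2 ->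
  d <= kappa ^+ 2 * (s ^+ 2 + r ^+ 2).
Proof.
move=> c0 mu0 sigma0 ell0 rho0 r0 s0 a0 beta C kappa ha hd.
have cmu0 : 0 < c * mu by rewrite mulr_gt0.
have rho1 : 0 <= 1 + rho by rewrite addr_ge0.
pose T := Num.sqrt (s ^+ 2 + r ^+ 2).
have T0 : 0 <= T by rewrite sqrtr_ge0.
have TT : T ^+ 2 = s ^+ 2 + r ^+ 2 by rewrite sqr_sqrtr ?addr_ge0 ?sqr_ge0.
have rT : r <= T.
  by rewrite -(@ler_pXn2r _ 2) ?nnegrE // TT lerDr sqr_ge0.
have sT : s <= T.
  by rewrite -(@ler_pXn2r _ 2) ?nnegrE // TT lerDl sqr_ge0.
(* The product [r * s] costs only half of [T ^+ 2], whence the factor 2 in the denominator under the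
   root in [C]. *)
have rsT : 2 * (r * s) <= T ^+ 2 by have := sqr_ge0 (r - s); rewrite TT; lra.
pose K := Num.sqrt ((1 + rho) / (2 * sigma * c * mu)).
have K0 : 0 <= K by rewrite sqrtr_ge0.
have KK : K ^+ 2 = (1 + rho) / (2 * sigma * c * mu).
  by rewrite sqr_sqrtr // divr_ge0 // !mulr_ge0 // ltW.
pose C1 := 1 / (c * mu) + ell / (mu * sigma).
have C10 : 0 <= C1 by rewrite addr_ge0 // divr_ge0 ?mulr_ge0 // ltW.
have CE : C = C1 + K by [].
have C0 : 0 <= C by rewrite CE addr_ge0.
have aC : a <= C * T.
  rewrite CE mulrDl; apply: quadratic_root_bound; rewrite ?mulr_ge0 //.
  have -> : (K * T) ^+ 2 = K ^+ 2 * T ^+ 2 by rewrite exprMn.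
  have -> : a ^+ 2 = (c * mu)^-1 * (c * mu * a ^+ 2).
    by rewrite mulrA mulVf ?mul1r ?gt_eqF.
  apply: le_trans (ler_wpM2l _ ha) _; first by rewrite invr_ge0 ltW.
  have -> : (c * mu)^-1 * (r * a + beta * s) =
    (1 / (c * mu) * r + ell / (mu * sigma) * s) * a + K ^+ 2 * (2 * (r * s)).
    rewrite KK /beta; field.
    by rewrite !gt_eqF.
  apply: lerD; last by rewrite ler_wpM2l ?sqr_ge0.
  rewrite ler_wpM2r // mulrDl; apply: lerD.
    by rewrite ler_wpM2l // divr_ge0 // ltW.
  by rewrite ler_wpM2l // divr_ge0 ?mulr_ge0 // ltW.
have betaT : beta <= (1 + rho + c * ell * C) / sigma * T.
  rewrite /beta [leRHS]mulrAC ler_wpM2r ?invr_ge0 ?(ltW sigma0) //.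
  rewrite [leRHS]mulrDl.
  apply: lerD; first by rewrite ler_wpM2l.
  by rewrite -[leRHS]mulrA ler_wpM2l // mulr_ge0 // ltW.
have beta0 : 0 <= beta.
  by rewrite divr_ge0 ?(ltW sigma0) // addr_ge0 ?mulr_ge0 // ltW.
apply: le_trans hd _; rewrite -TT sqr_sqrtr ?addr_ge0 ?sqr_ge0 //.
rewrite mulrDl addrC -!exprMn; apply: lerD.
  by rewrite ler_pXn2r ?nnegrE // mulr_ge0.
by rewrite ler_pXn2r ?nnegrE //; apply: le_trans betaT.
Qed.

(** * Elimination of the tracking variable *)

Section Tracking.
Variables (R : realType) (N n : nat) (f : 'I_N -> 'cV[R]_n -> R).
Variables (Z : 'I_N -> set 'cV[R]_n) (w : 'M[R]_N) (c : R).
Variables (z g q : nat -> 'I_N -> 'cV[R]_n).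
Hypothesis c0 : 0 < c.
Hypothesis hiter : proximal_tracking f Z w c z g q.

Let W : 'M[R]_(N * n) := kronI n w.
Let L : 'M[R]_(N * n) := 1%:M - W.

Lemma y_iterS k : y_iter w z k.+1 = y_iter w z k + L *m stack (z k.+1).
Proof. by rewrite /y_iter big_ord_recr. Qed.

Lemma stack_mix (v : 'I_N -> 'cV[R]_n) i :
  \sum_j w i j *: v j = blk (W *m stack v) i.
Proof. by rewrite blk_kronI; apply: eq_bigr => j _; rewrite blk_stack. Qed.

Lemma tracking_q k : c *: stack (q k.+1) =
  W *m stack (z k) - stack (z k.+1)
    + c *: stack (q k) - c *: (W *m stack (g k)).
Proof.
apply: blk_inj => i; have [_ qE _] := tracking_step hiter k i.
rewrite !(blkB, blkD, blkZ) !blk_stack qE !stack_mix.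
by rewrite scalerBr scalerDr scalerA divff ?gt_eqF // scale1r.
Qed.

Lemma tracking_g k : c *: stack (g k.+1) = W *m stack (z k) - stack (z k.+1).
Proof.
apply: blk_inj => i; have [_ qE gE] := tracking_step hiter k i.
rewrite !(blkB, blkZ) !blk_stack gE qE !stack_mix.
by rewrite (addrC (blk _ i)) subrK addrK scalerA divff ?gt_eqF // scale1r.
Qed.

(** The part of [tracking_q] that involves [q] and [g] depends only on the history of [z], through
    [y_iter]. The zero initial values start the induction. *)
Lemma tracking_invariant k :
  c *: stack (q k) - c *: (W *m stack (g k))
    = - (L *m (W *m stack (z k) + y_iter w z k)).
Proof.
elim: k => [|k IHk].
  have stack0 (v : 'I_N -> 'cV[R]_n) : (forall i, v i = 0) -> stack v = 0.
    by move=> v0; apply/colP => j; rewrite !mxE v0 mxE.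
  have [z0 g0 q0] :
      [/\ stack (z 0%N) = 0, stack (g 0%N) = 0 & stack (q 0%N) = 0].
    by split; apply: stack0 => i; have [] := tracking_init hiter i.
  by rewrite /y_iter big_ord1 z0 g0 q0 !(mulmx0, scaler0, addr0) subrr oppr0.
rewrite tracking_q -(addrA (_ - _)) IHk scalemxAr tracking_g y_iterS.
rewrite /L !mulmx_laplacian !(mulmxDr, mulmxN).
move: (W *m (W *m stack (z k))) (W *m (W *m stack (z k.+1))) => v1 v2.
move: (W *m stack (z k)) (W *m stack (z k.+1)) => v3 v4.
move: (W *m y_iter w z k) (y_iter w z k) (stack (z k.+1)) => v5 v6 v7.
by apply/colP => i; rewrite !mxE; ring.
Qed.

Lemma tracking_iteration k : c *: stack (q k.+1) =
  W *m (W *m stack (z k)) - stack (z k.+1) - L *m y_iter w z k.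
Proof.
(* The two terms in [W z^k] combine by [W - (I - W) W = W^2]. *)
rewrite tracking_q -(addrA (_ - _)) tracking_invariant mulmxDr.
rewrite /L !mulmx_laplacian.
move: (W *m (W *m stack (z k))) (W *m stack (z k)) => v1 v2.
move: (W *m y_iter w z k) (y_iter w z k) => v3 v4.
by apply/colP => i; rewrite !mxE; ring.
Qed.

(** The update formula of [q] is exactly the subgradient given by the optimality condition of the
    proximal step. *)
Lemma tracking_subdiff mu k : 0 <= mu -> (forall i, convex_set (Z i)) ->
  (forall i, strongly_convex mu (f i)) ->
  stacked_subdiff f Z (stack (z k.+1)) (stack (q k.+1)).
Proof.
move=> mu0 Zc fs i; rewrite !blk_stack.
have [zmin -> _] := tracking_step hiter k i.
have := prox_subdiff (Zc i) (fs i) mu0 c0 zmin.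
by rewrite opprB addrA.
Qed.

End Tracking.

(** * Contraction *)

Section Convergence.
Variables (R : realType) (N n : nat) (f : 'I_N -> 'cV[R]_n -> R).
Variables (Z : 'I_N -> set 'cV[R]_n) (E : rel 'I_N) (w : 'M[R]_N).
Variables (c mu : R) (zs : 'cV[R]_n).
Hypothesis net : network E w.
Hypothesis c0 : 0 < c.
Hypothesis mu0 : 0 < mu.
Hypothesis Zconvex : forall i, convex_set (Z i).
Hypothesis fstrong : forall i, strongly_convex mu (f i).
Hypothesis Zzs : forall i, Z i zs.

Let W : 'M[R]_(N * n) := kronI n w.
Let L : 'M[R]_(N * n) := 1%:M - W.
Let zz : 'cV[R]_(N * n) := stack (fun _ => zs).

Let symW : W^T = W.
Proof. exact/kronI_sym/weight_sym/net. Qed.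

Let specW l : eigenvalue W l -> 0 < l <= 1.
Proof. exact: (kronI_eigenvalue net). Qed.

Lemma FzerosE x : Fzeros f Z w c x <->
  W *m x.2 = x.2 /\
  exists2 q, stacked_subdiff f Z x.2 q & c *: q + L *m x.1 = 0.
Proof.
have MU := metric_unitmx symW specW.
split=> [[/= xL [q qx qL]]|[Wx [q qx qL]]].
  split; first by apply/esym/eqP; rewrite -subr_eq0 -mulmx_laplacian -xL.
  by exists q => //; rewrite -[LHS](mulKVmx MU) qL mulmx0.
split; first by rewrite /= mulmx_laplacian Wx subrr.
by exists q => //; rewrite -/W -/L qL mulmx0.
Qed.

Lemma stacked_subdiff_strongly_monotone x y p q :
  stacked_subdiff f Z x p -> stacked_subdiff f Z y q ->
  mu * enorm (x - y) ^+ 2 <= dotv (p - q) (x - y).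
Proof.
move=> px qy; rewrite sqr_enorm !dotv_blk mulr_sumr; apply: ler_sum => i _.
rewrite !blkB -sqr_enorm.
apply: (subdiff_strongly_monotone (@Zconvex i) (@fstrong i) (px i) (qy i)).
by have [] := (subdiff_phiP f _ _ (Zzs i)).1 (qy i).
Qed.

Lemma distA2_le x x' :
  Fzeros f Z w c x' ->
  distA2 W x (Fzeros f Z w c) <= normA2 W (x.1 - x'.1, x.2 - x'.2).
Proof.
move=> Fx'; apply: ge_inf; last by exists x'.
by exists 0 => _ [u _ <-]; exact: normA2_ge0.
Qed.

(** Writing [q = L v], the vector [- c v] already solves the equation for [y'];
    [laplacian_error_bound] moves it along the kernel of [L] to a solution close to [y]. *)
Lemma Fzeros_Qstar (y q : 'cV[R]_(N * n)) : Qstar f Z w zs q ->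
  exists y' : 'cV[R]_(N * n),
    Fzeros f Z w c (y', zz) /\ L *m y' = - (c *: q) /\
    spectral_gap w * enorm (y - y') <= enorm (c *: q + L *m y).
Proof.
move=> [qz [v _ qv]].
have gap l : eigenvalue W l -> l < 1 -> l <= 1 - spectral_gap w.
  by move=> /(eigenvalue_kronI (weight_sym net)); exact: le_spectral_gap.
have [y' [Ly' dy']] :=
  laplacian_error_bound symW specW y (- (c *: v)) (spectral_gap_gt0 net) gap.
have Lv : (1%:M - W) *m - (c *: v) = - (c *: q).
  by rewrite mulmxN -scalemxAr qv.
exists y'; split; last split.
- apply/FzerosE; split; first exact: (kronI_consensus net).
  by exists q => //=; rewrite /L Ly' Lv subrr.
- by rewrite /L Ly' Lv.
- by apply: le_trans dy' _; rewrite mulmxBr Lv opprK addrC.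
Qed.

(** Calmness and the spectral gap bound the distance in [y] by [beta], strong monotonicity bounds
    [a] in terms of [beta] and the residuals, and [residual_bound] resolves this mutual
    dependence. *)
Lemma calm_error_bound ell rho delta (y z q : 'cV[R]_(N * n)) :
  0 <= ell -> 0 <= rho -> Qstar f Z w zs !=set0 ->
  calmness f Z w zs ell rho delta ->
  ((enorm (z - zz))%:E <= delta)%E -> stacked_subdiff f Z z q ->
  let sigma := spectral_gap w in
  let C := 1 / (c * mu) + ell / (mu * sigma)
           + Num.sqrt ((1 + rho) / (2 * sigma * c * mu)) in
  let kappa := Num.sqrt (C ^+ 2 + ((1 + rho + c * ell * C) / sigma) ^+ 2) in
  (distA2 W (y, z) (Fzeros f Z w c)
    <= kappa ^+ 2 * (enorm (L *m z) ^+ 2 + enorm (c *: q + L *m y) ^+ 2)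
    : Prop).
Proof.
move=> ell0 rho0 Q0 calm near qz sigma C kappa.
have sigma0 : 0 < sigma := spectral_gap_gt0 net.
set r := enorm (c *: q + L *m y); set s := enorm (L *m z).
set a := enorm (z - zz).
have [r0 s0 a0] : [/\ 0 <= r, 0 <= s & 0 <= a] by split; exact: enorm_ge0.
pose beta := ((1 + rho) * r + c * ell * a) / sigma.
have beta0 : 0 <= beta.
  by rewrite divr_ge0 ?(ltW sigma0) // addr_ge0 // !mulr_ge0 ?addr_ge0 // ltW.
(* The point [- L y / c] of the range is at distance [r / c] from [q]. *)
have distr : dist q (mxrange L) <= r / c.
  apply: ge_inf; first by exists 0 => _ [u _ <-]; exact: enorm_ge0.
  exists (L *m - (c^-1 *: y)); first by exists (- (c^-1 *: y)).
  have -> : q - L *m - (c^-1 *: y) = c^-1 *: (c *: q + L *m y).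
    by rewrite mulmxN opprK -scalemxAr scalerDr scalerA mulVf ?scale1r ?gt_eqF.
  by rewrite enormZ gtr0_norm ?invr_gt0 // mulrC.
have distq : dist q (Qstar f Z w zs) <= ell * a + rho * (r / c).
  apply: le_trans (calm z _ near q qz) _; first by exists q.
  by rewrite lerD2l ler_wpM2l.
(* [dist] is an infimum, so a nearly closest point of [Qstar] is taken, at the price of a slack [t]
   that tends to 0 at the end. *)
have approx t : 0 < t ->
    distA2 W (y, z) (Fzeros f Z w c) <= (beta + t) ^+ 2 + a ^+ 2 /\
    c * mu * a ^+ 2 <= r * a + (beta + t) * s.
  (* The tolerance is scaled so that, after multiplication by [c] and division by [sigma], it
     becomes [t]. *)
  move=> t0; have e0 : 0 < sigma * t / c by rewrite divr_gt0 ?mulr_gt0.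
  have [|_ [qs Qqs <-] qqs] := @inf_adherent R
      [set enorm (q - v) | v in Qstar f Z w zs] _ e0.
    split; first by case: Q0 => u Qu; exists (enorm (q - u)), u.
    by exists 0 => _ [u _ <-]; exact: enorm_ge0.
  have [ys [Fys [Lys dys]]] := Fzeros_Qstar y Qqs.
  have dyt : enorm (y - ys) <= beta + t.
    rewrite -(ler_pM2l sigma0); apply: le_trans dys _.
    have -> : c *: qs + L *m y = (c *: q + L *m y) - c *: (q - qs).
      by rewrite scalerBr opprB [RHS]addrC addrA subrK.
    apply: le_trans (enormD _ _) _; rewrite enormN enormZ gtr0_norm //.
    have : c * enorm (q - qs) <= c * (ell * a + rho * (r / c) + sigma * t / c).
      by rewrite ler_pM2l //; apply/ltW/(lt_le_trans qqs); rewrite lerD2r.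
    have -> : c * (ell * a + rho * (r / c) + sigma * t / c) =
        c * ell * a + rho * r + sigma * t by field; rewrite gt_eqF.
    have -> : sigma * (beta + t) = (1 + rho) * r + c * ell * a + sigma * t.
      by rewrite /beta; field; rewrite gt_eqF.
    by rewrite -/r; lra.
  split.
    apply: le_trans (distA2_le _ Fys) _; rewrite /normA2 /=.
    apply: lerD; last exact: metric_le_sqr_enorm.
    by rewrite ler_pXn2r ?nnegrE ?enorm_ge0 // addr_ge0 // ltW.
  have /FzerosE[/= Wzz _] := Fys.
  apply: le_trans (_ : c * dotv (q - qs) (z - zz) <= _).
    rewrite -mulrA ler_pM2l //.
    exact: stacked_subdiff_strongly_monotone qz Qqs.1.
  (* [c (q - qs)] is the residual minus [L (y - ys)]; the symmetric [L] passes to the other side,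
     where it annihilates [zz]. *)
  have -> : c * dotv (q - qs) (z - zz) =
      dotv (c *: q + L *m y) (z - zz) + dotv (y - ys) (- (L *m z)).
    rewrite -dotvZl; have -> : c *: (q - qs) = c *: q + L *m y - L *m (y - ys).
      rewrite mulmxBr Lys scalerBr.
      move: (c *: q) (c *: qs) (L *m y) => u1 u2 u3.
      by apply/colP => i; rewrite !mxE; ring.
    rewrite [LHS]dotvDl [X in _ + X]dotvNl [X in _ = _ + X]dotvNr.
    congr (_ - _).
    rewrite dotv_mulmx; have -> : L^T = L by rewrite /L linearB /= trmx1 symW.
    by rewrite mulmxBr /L [_ *m zz]mulmx_laplacian Wzz subrr subr0.
  apply: lerD; first exact: dotv_le_enorm.
  apply: le_trans (dotv_le_enorm _ _) _; rewrite enormN.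
  by rewrite ler_wpM2r.
apply: (@residual_bound _ c mu sigma ell rho r s a) => //.
  apply: (@le_infinitesimal _ _ _ s) => t /andP[t0 _].
  by have [_] := approx t t0; rewrite -/beta; lra.
(* For [t <= 1], [(beta + t)^2] exceeds [beta^2] by at most [t * (2 * beta + 1)]. *)
apply: (@le_infinitesimal _ _ _ (2 * beta + 1)) => t /andP[t0 t1].
have [h _] := approx t t0; apply: le_trans h _; rewrite -/beta.
have : t * t <= t * 1 by rewrite ler_pM2l.
lra.
Qed.

Variables (z g q : nat -> 'I_N -> 'cV[R]_n).
Hypothesis hiter : proximal_tracking f Z w c z g q.

Let x := x_iter w z.
Let res k := enorm (L *m stack (z k)) ^+ 2
  + enorm (c *: stack (q k) + L *m y_iter w z k) ^+ 2.

Lemma iterate_subdiff k :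
  stacked_subdiff f Z (stack (z k.+1)) (stack (q k.+1)).
Proof. exact: (tracking_subdiff c0 hiter _ (ltW mu0)). Qed.

Lemma iterate_descent k xs : Fzeros f Z w c xs ->
  normA2 W ((x k.+1).1 - xs.1, (x k.+1).2 - xs.2)
    + 2 * c * mu * enorm (stack (z k.+1) - xs.2) ^+ 2
    + (2 * lambda_min W - lambda_min W ^+ 2) * res k.+1
  <= normA2 W ((x k).1 - xs.1, (x k).2 - xs.2).
Proof.
move=> /FzerosE[Wxs [qs xqs Lxs]].
have := one_step symW specW (@kronI_lambda_min _ _ _ _ net n) Wxs Lxs
  (tracking_iteration c0 hiter k) (y_iterS w z k).
apply: le_trans; rewrite lerD2r lerD2l -!mulrA !ler_pM2l //.
exact: stacked_subdiff_strongly_monotone (iterate_subdiff k) xqs.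
Qed.

Lemma descent_rate_ge0 : (0 < N)%N -> (0 < n)%N ->
  0 <= 2 * lambda_min W - lambda_min W ^+ 2.
Proof.
move=> N0 n0; have /andP[l0 l1] := kronI_lambda_min_bounds net N0 n0.
have : 0 <= lambda_min W * (2 - lambda_min W) by rewrite mulr_ge0 //; lra.
lra.
Qed.

(** The squared A-distance [V] to one fixed zero decreases and is bounded below, and each of its
    drops dominates a multiple of the squared error of [z]. *)
Lemma iterates_converge (d : R) : (0 < N)%N -> (0 < n)%N ->
  Qstar f Z w zs !=set0 -> 0 < d ->
  exists k0, forall k, (k0 <= k)%N -> enorm (stack (z k) - zz) <= d.
Proof.
move=> N0 n0 [qs Qqs] d0; have [ys [Fys _]] := Fzeros_Qstar 0 Qqs.
pose V k := normA2 W ((x k).1 - ys, (x k).2 - zz).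
have lam0 := descent_rate_ge0 N0 n0.
have Vdecr k : V k.+1 + 2 * c * mu * enorm (stack (z k.+1) - zz) ^+ 2 <= V k.
  apply: le_trans (iterate_descent k Fys); rewrite lerDl mulr_ge0 //.
  by rewrite addr_ge0 ?sqr_ge0.
have cmu0 : 0 < 2 * c * mu by rewrite !mulr_gt0.
have Vle j k : V (k + j)%N <= V k.
  elim: j => [|j IHj]; first by rewrite addn0.
  rewrite addnS; apply: le_trans IHj; apply: le_trans (Vdecr _).
  by rewrite lerDl mulr_ge0 ?sqr_ge0 // ltW.
have Vlb : has_lbound (range V).
  by exists 0 => _ [k _ <-]; exact: normA2_ge0.
(* Once [V] is this close to its infimum, every later drop is below [2 c mu d^2]. *)
have [||_ [k0 _ <-] Vk0] := @inf_adherent R (range V) (2 * c * mu * d ^+ 2).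
- by rewrite mulr_gt0 // exprn_gt0.
- by split=> //; exists (V 0%N), 0%N.
(* The drop from [V k] to [V k.+1] controls the iterate of index [k.+1], hence the shift. *)
exists k0.+1 => -[//|k]; rewrite ltnS => /subnKC kE.
rewrite -(@ler_pXn2r _ 2) ?nnegrE ?enorm_ge0 ?(ltW d0) // -(ler_pM2l cmu0).
have := Vdecr k; have := Vle (k - k0)%N k0; rewrite kE.
have : inf (range V) <= V k.+1 by apply: ge_inf => //; exists k.+1.
lra.
Qed.

(** The descent of the distance is at least the rate times [res k.+1], and [res k.+1] is at least
    the new distance over [kappa ^+ 2]; so the new distance times [1 + theta] is at most the old
    one. *)
Lemma contraction ell rho delta k :
  (0 < N)%N -> (0 < n)%N ->
  0 <= ell -> 0 <= rho -> Qstar f Z w zs !=set0 ->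
  calmness f Z w zs ell rho delta ->
  ((enorm (stack (z k.+1) - zz))%:E <= delta)%E ->
  let sigma := spectral_gap w in
  let C := 1 / (c * mu) + ell / (mu * sigma)
           + Num.sqrt ((1 + rho) / (2 * sigma * c * mu)) in
  let kappa := Num.sqrt (C ^+ 2 + ((1 + rho + c * ell * C) / sigma) ^+ 2) in
  let theta := (2 * lambda_min W - lambda_min W ^+ 2) / kappa ^+ 2 in
  (distA2 W (x k.+1) (Fzeros f Z w c)
    <= 1 / (1 + theta) * distA2 W (x k) (Fzeros f Z w c) : Prop).
Proof.
move=> N0 n0 ell0 rho0 Q0 calm near sigma C kappa theta.
have [qs Qqs] := Q0; have [ys [Fys _]] := Fzeros_Qstar 0 Qqs.
have sigma0 : 0 < sigma := spectral_gap_gt0 net.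
have lam0 := descent_rate_ge0 N0 n0.
have C0 : 0 < C.
  apply: ltr_pwDl; last exact: sqrtr_ge0.
  apply: ltr_pwDl; first by rewrite divr_gt0 ?mulr_gt0.
  by rewrite divr_ge0 // mulr_ge0 // ltW.
have kappa0 : 0 < kappa ^+ 2.
  rewrite sqr_sqrtr ?addr_ge0 ?sqr_ge0 //.
  by rewrite ltr_pwDl ?sqr_ge0 // exprn_gt0.
have dist_res := calm_error_bound (y_iter w z k.+1)
  ell0 rho0 Q0 calm near (iterate_subdiff k).
(* The residual term does not depend on the zero [xs], so the infimum over [xs] can be taken in
   [iterate_descent]. *)
have dist_desc : distA2 W (x k.+1) (Fzeros f Z w c)
    + (2 * lambda_min W - lambda_min W ^+ 2) * res k.+1
    <= distA2 W (x k) (Fzeros f Z w c).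
  apply: lb_le_inf.
    by exists (normA2 W ((x k).1 - ys, (x k).2 - zz)), (ys, zz).
  move=> _ [xs Fxs <-]; apply: le_trans (iterate_descent k Fxs).
  rewrite lerD2r; apply: le_trans (distA2_le _ Fxs) _.
  by rewrite lerDl mulr_ge0 ?sqr_ge0 // !mulr_ge0 // ltW.
have theta0 : 0 <= theta by rewrite divr_ge0 // ltW.
rewrite div1r mulrC ler_pdivlMr ?ltr_wpDr // mulrDr mulr1.
apply: le_trans dist_desc; rewrite lerD2l mulrC /theta -mulrA.
rewrite ler_wpM2l // mulrC ler_pdivrMr // mulrC.
exact: dist_res.
Qed.

End Convergence.

Theorem theorem8 (R : realType) (N n : nat) (f : 'I_N -> 'cV[R]_n -> R)
    (Z : 'I_N -> set 'cV[R]_n) (E : rel 'I_N) (w : 'M[R]_N)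
    (c mu ell rho : R) (delta : \bar R) (zs : 'cV[R]_n)
    (z g q : nat -> 'I_N -> 'cV[R]_n)
    (hN : (2 <= N)%N) (hn : (1 <= n)%N) (hc : 0 < c)
    (hproblem : convex_problem f Z)
    (hnetwork : network E w)
    (hmu : 0 < mu) (hstrong : forall i, strongly_convex mu (f i))
    (hzs : optimal_solutions f Z zs)
    (hQstar : Qstar f Z w zs !=set0)
    (hell : 0 <= ell) (hrho : 0 <= rho) (hdelta : (0 < delta)%E)
    (hcalm : calmness f Z w zs ell rho delta)
    (hiter : proximal_tracking f Z w c z g q) :
  let W := kronI n w in
  let sigma := spectral_gap w in
  let C := 1 / (c * mu) + ell / (mu * sigma)
           + Num.sqrt ((1 + rho) / (2 * sigma * c * mu)) in
  let kappa := Num.sqrt (C ^+ 2 + ((1 + rho + c * ell * C) / sigma) ^+ 2) in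
  let theta := (2 * lambda_min W - lambda_min W ^+ 2) / kappa ^+ 2 in
  let contracts_at (k : nat) : Prop :=
    distA2 W (x_iter w z k.+1) (Fzeros f Z w c)
      <= 1 / (1 + theta) * distA2 W (x_iter w z k) (Fzeros f Z w c) in
  let near_from (k0 : nat) : Prop :=
    forall k : nat, (k0 <= k)%N ->
      ((enorm (stack (z k) - stack (fun _ => zs)))%:E <= delta)%E in
  (delta = +oo%E -> forall k : nat, contracts_at k) /\
  ((delta < +oo)%E ->
     (exists k0 : nat, near_from k0) /\
     (forall k0 : nat, near_from k0 ->
        forall k : nat, (k0 <= k)%N -> contracts_at k)).
Proof.
move=> W sigma C kappa theta contracts_at near_from.
have Zzs i : Z i zs by have [/(_ i I)] := hzs.
have Zconvex := problem_convex_set hproblem.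
have N0 : (0 < N)%N by exact: leq_trans hN.
(* Closeness is asked of the new iterate, since the error bound is applied at [x^{k+1}]. *)
have contr k : ((enorm (stack (z k.+1) - stack (fun _ => zs)))%:E <= delta)%E ->
    contracts_at k.
  exact: (contraction hnetwork hc hmu Zconvex hstrong Zzs hiter N0 hn hell hrho
    hQstar hcalm).
split=> [deltaoo k|deltafin]; first by apply: contr; rewrite deltaoo leey.
split=> [|k0 near k k0k]; last by apply/contr/near/(leq_trans k0k).
(* Only a finite [d] survives: [hdelta] excludes minus infinity and [deltafin] plus infinity. *)
case: delta hdelta hcalm contr @near_from deltafin => [d| |] // d0 _ _ near _.
have [k0 hk0] := iterates_converge hnetwork hc hmu Zconvex hstrong Zzs hiter
  N0 hn hQstar d0.
by exists k0 => k /hk0; rewrite lee_fin.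
Qed.
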